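(* Let $-1<r_1<\dots<r_\kappa\le 0$ be real numbers and let $m_1,\dots,m_\kappa$ be positive integers. Then $$\mathrm{Aut}\Big(\perp_{i=1}^{\kappa}\mathcal{K}^{m_i}(r_i)\Big)=O(m_1,\dots,m_\kappa,A_\infty).$$
   Context: Let $k$ be a field, $A=k[t]$, $K=k(t)$, with degree function $|a/b|=\deg a-\deg b$ for nonzero $a,b\in A$, $|0|=-\infty$. Let $A_\infty=\{x\in K: |x|\le 0\}$ (a discrete valuation ring) with maximal ideal $\mathfrak m_\infty=\{x\in K:|x|<0\}$. The normed space $\perp_{i=1}^{\kappa}\mathcal{K}^{m_i}(r_i)$ is $K^n$ with $n=m_1+\cdots+m_\kappa$, equipped with the norm $\|(a_1,\dots,a_n)\|=\max_{1\le j\le n}(|a_j|+r_{i(j)})$, where $i(j)$ is the index with $m_1+\cdots+m_{i(j)-1}<j\le m_1+\cdots+m_{i(j)}$. For a normed space $E$, $\mathrm{Aut}(E)$ is the group of isometries of $E$ onto itself, i.e. the bijective $K$-linear maps $\varphi:E\to E$ with $\|\varphi(x)\|=\|x\|$ for all $x$. For $E=\perp_{i=1}^{\kappa}\mathcal{K}^{m_i}(r_i)$, that is, $E=K^n$ equipped with the norm $\|(a_1,\dots,a_n)\|=\max_{1\le j\le n}(|a_j|+r_{i(j)})$, $\mathrm{Aut}(E)$ is regarded as a subgroup of $\mathrm{GL}_n(K)$, a matrix $T$ acting on row vectors by $x\mapsto xT$. For a partition $n=m_1+\cdots+m_\kappa$ into positive integers, decompose an $n\times n$ matrix $T$ over $A_\infty$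 into blocks $T=(T_{ij})$, $T_{ij}\in A_\infty^{m_i\times m_j}$, $1\le i,j\le\kappa$. The orthonormal group $O(m_1,\dots,m_\kappa,A_\infty)$ is the subgroup of $\mathrm{GL}_n(A_\infty)$ formed by all $T\in A_\infty^{n\times n}$ with (1) $T_{ii}\in\mathrm{GL}_{m_i}(A_\infty)$ for all $1\le i\le\kappa$, and (2) $T_{ij}\in\mathfrak m_\infty^{m_i\times m_j}$ for all $j>i$. *)

(* Defs.v *)
From HB Require Import structures.
From mathcomp Require Import all_boot all_order all_algebra.
From mathcomp Require Import fraction.
From mathcomp Require Import all_classical all_reals.

Set Implicit Arguments.
Unset Strict Implicit.
Unset Printing Implicit Defensive.

Import Order.TTheory GRing.Theory Num.Theory.
Local Open Scope ring_scope.

Notation ratfun k := {fraction {poly k}}.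

Section Degree.
Variable k : fieldType.
Implicit Types (p a b : {poly k}) (x : ratfun k).

(* Only used for p != 0, where (size p).-1 is the degree of p. *)
Definition pdeg p : int := (size p).-1%:Z.

(* The value does not depend on the fraction chosen to represent x:
   see fdeg_div below. *)
Definition fdeg x : \bar int :=
  if x == 0 then -oo%E
  else (pdeg \n_(repr x) - pdeg \d_(repr x))%:E%E.

Lemma fdeg0 : fdeg 0 = -oo%E.
Proof. by rewrite /fdeg eqxx. Qed.

Lemma pdegM a b : a != 0 -> b != 0 -> pdeg (a * b) = pdeg a + pdeg b.
Proof.
move=> a0 b0; rewrite /pdeg size_mul // -PoszD; congr (Posz _).
move: a0 b0; rewrite -!size_poly_gt0.
by case: (size a) (size b) => [|m] [|n] //= _ _; rewrite addnS.
Qed.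

Lemma ratfun_repr x : x = tofrac \n_(repr x) / tofrac \d_(repr x).
Proof.
have d0 : tofrac \d_(repr x) != 0 by rewrite tofrac_eq0 denom_ratioP.
apply: (mulIf d0); rewrite divfK // -[X in X * _ = _]reprK.
unlock FracField.tofrac; rewrite -[LHS]FracField.pi_mul.
apply/eqmodP; rewrite /= FracField.equivfE /FracField.mulf.
by rewrite !numden_Ratio ?mulr1 ?oner_neq0 ?denom_ratioP // mulrC.
Qed.

Lemma fdeg_div a b : a != 0 -> b != 0 ->
  fdeg (tofrac a / tofrac b) = (pdeg a - pdeg b)%:E%E.
Proof.
move=> a0 b0.
have cross (F : fieldType) (u v w z : F) :
    v != 0 -> z != 0 -> u / v = w / z -> u * z = w * v.
  by move=> v0 z0 /eqP; rewrite eqr_div // => /eqP.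
have ta0 : tofrac a != 0 by rewrite tofrac_eq0.
have tb0 : tofrac b != 0 by rewrite tofrac_eq0.
have [x xab] : {x | x = tofrac a / tofrac b} by exists (tofrac a / tofrac b).
have x0 : x != 0 by rewrite xab (mulf_neq0 ta0 (invr_neq0 tb0)).
rewrite -xab.
rewrite /fdeg (negPf x0).
have := ratfun_repr x; move: (denom_ratioP (repr x)).
move: \n_(repr x) \d_(repr x) => n d d0 xE.
have td0 : tofrac d != 0 by rewrite tofrac_eq0.
have n0 : n != 0.
  by apply: contraNneq x0 => n0; rewrite xE n0 tofrac0 mul0r.
have : tofrac (a * d) = tofrac (n * b).
  by rewrite (tofracM a) (tofracM n); exact: cross tb0 td0 (etrans (esym xab) xE).
move/eqP; rewrite tofrac_eq => /eqP/(congr1 pdeg).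
rewrite !pdegM // => e; congr (_%:E)%E.
by apply/eqP; rewrite subr_eq addrAC eq_sym subr_eq e.
Qed.

Definition Ainf : {pred ratfun k} := [pred x | (fdeg x <= 0%:E)%E].

Definition minf : {pred ratfun k} := [pred x | (fdeg x < 0%:E)%E].

End Degree.

Section NormedSpaces.
Variables (k : fieldType) (R : realType).
Local Notation K := (ratfun k).

(* ||(a_1, ..., a_n)|| = max_j (|a_j| + r_{i(j)}), where n = \sum_i m i.
   tagnat.sig1 j is the index i(j) of the block containing j (tagnat.rect),
   for the same block decomposition as the one used by submxblock. *)
Definition perp_norm (kappa : nat) (m : 'I_kappa -> nat) (r : 'I_kappa -> R)
    (x : 'rV[K]_(\sum_(i < kappa) m i)) : \bar R :=
  \big[Order.max/-oo%E]_(j < \sum_(i < kappa) m i)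
    (er_map intr (fdeg (x ord0 j)) + (r (tagnat.sig1 j))%:E)%E.

Definition Aut (E : lmodType K) (N : E -> \bar R) : set (E -> E) :=
  [set phi | [/\ linear phi, bijective phi & forall x, N (phi x) = N x]].

(* Aut inside GL_n(K), matrices acting on row vectors by x |-> x T. *)
Definition mxAut (n : nat) (N : 'rV[K]_n -> \bar R) : set 'M[K]_n :=
  [set T | Aut N (fun x => x *m T)].

End NormedSpaces.

Definition GLinf (k : fieldType) (n : nat) : set 'M[ratfun k]_n :=
  [set T | T \is a mxOver (@Ainf k) /\
     exists2 U, U \is a mxOver (@Ainf k) & T *m U = 1%:M /\ U *m T = 1%:M].

Definition orthonormal_group (k : fieldType) (kappa : nat) (m : 'I_kappa -> nat) :
    set 'M[ratfun k]_(\sum_(i < kappa) m i) :=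
  [set T | [/\ T \is a mxOver (@Ainf k),
     forall i, GLinf (submxblock T i i) &
     forall i j : 'I_kappa, (i < j)%N -> submxblock T i j \is a mxOver (@minf k)]].
Arguments orthonormal_group k [kappa] m.
Arguments perp_norm k [R kappa] m r x.

(* Main.v *)
Require Import Defs.
From mathcomp Require Import all_boot all_order all_algebra.
From mathcomp Require Import fraction lra.
From mathcomp Require Import all_classical all_reals.
Import Order.TTheory GRing.Theory Num.Theory.
Local Open Scope ring_scope.

(** Everything rests on one arithmetic fact: degrees of nonzero rational
functions are integers, while the weights [r i] are distinct and, lying in
[(-1, 0]], differ by less than [1].  Hence [|a| + r i = |b| + r j] with [a]
nonzero forces [i = j] ([weighted_degree_inj]): the norm of a nonzero vector
determines the one block in which it is attained, and the largest degree of
the entries in that block ([wnorm_leading_block]).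

Evaluating on unit vectors, a matrix [T] does not increase a weighted maximum
norm iff [|T j l| + w l <= w j] for all entries ([wcontractionP]).  With
integral degrees and weights in [(-1, 0]], these inequalities say precisely
that the entries of [T] have degree at most [0], and degree less than [0] in
the blocks above the diagonal.  In the same way, with all weights equal to
[0], a square matrix lies in GL over the valuation ring iff it is an isometry
for the maximum norm ([GLinfP]); so units of matrix rings are handled without
determinants.

It remains to match the isometry condition with the diagonal blocks.  If [T]
is an isometry, apply it to a vector supported in block [i]: the image has the
same norm, so by the arithmetic fact it attains it in block [i], which says
that [T_ii] is an isometry for the maximum norm.  Conversely, let [T] be in
the orthonormal group, and let [x] be nonzero with leading block [i].  The
component of [x T] in block [i] is [x_i T_ii] plus contributions of the other
blocks of [x]; the former attains the norm because [T_ii] is an isometry, and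
the latter are strictly smaller because [x] attains its norm only in block
[i].  By the ultrametric inequality nothing cancels, so the norm of [x T] is
at least that of [x]. *)

(** * The degree as a valuation with values in the extended reals *)

(** Mapping degrees into the extended reals at once puts them in the type in
which the weights are added to them. *)
Definition rdeg {k : fieldType} (R : realType) (x : ratfun k) : \bar R :=
  er_map intr (fdeg x).
Arguments rdeg {k} R x%_ring_scope.

Section Expand.
Set Implicit Arguments.
Unset Strict Implicit.
Variable D : idomainType.
Implicit Types a b c : D.

(** This and the next lemma are stated over an abstract domain so that the field
lemmas unify without unfolding the fraction field of polynomials. *)
Lemma tofrac_expandr a b c : c != 0 ->
  tofrac a / tofrac b = tofrac (a * c) / tofrac (b * c).
Proof. by move=> c0; rewrite !tofracM -mulf_div divff ?mulr1 // tofrac_eq0. Qed.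

Lemma tofrac_expandl a b c : c != 0 ->
  tofrac a / tofrac b = tofrac (a * c) / tofrac (c * b).
Proof. by move=> c0; rewrite (mulrC c); exact: tofrac_expandr. Qed.

End Expand.

Section RealDegree.
Set Implicit Arguments.
Unset Strict Implicit.
Variables (k : fieldType) (R : realType).
Implicit Types (x y : ratfun k) (p q : {poly k}).
Local Notation v := (@rdeg k R).

Lemma rdeg0 : v 0 = -oo%E.
Proof. by rewrite /rdeg fdeg0. Qed.

Lemma rdeg_div p q : p != 0 -> q != 0 ->
  v (tofrac p / tofrac q) = ((size p)%:R - (size q)%:R)%:E%E.
Proof.
move=> p0 q0; rewrite /rdeg fdeg_div // /pdeg /= intrB -!pmulrn.
rewrite -[size p]prednK ?size_poly_gt0 // -[size q]prednK ?size_poly_gt0 //=.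
by rewrite -!natr1; congr (_%:E)%E; lra.
Qed.

Lemma rdeg_fin x : x != 0 -> {z : int | v x = (z%:~R)%:E%E}.
Proof.
by move=> /negPf x0; rewrite /rdeg /fdeg x0 /=; eexists.
Qed.

Lemma rdegE x : x != 0 ->
  exists p q, [/\ p != 0, q != 0 & x = tofrac p / tofrac q].
Proof.
move=> x0; exists \n_(repr x), \d_(repr x); split; last exact: ratfun_repr.
  apply: contraNneq x0 => n0.
  by rewrite (ratfun_repr x) n0 tofrac0 mul0r.
exact: denom_ratioP.
Qed.

Lemma rdegM x y : v (x * y) = (v x + v y)%E.
Proof.
have [->|x0] := eqVneq x 0; first by rewrite mul0r rdeg0.
have [->|y0] := eqVneq y 0; first by rewrite mulr0 rdeg0 addeNy.
have [p [q [p0 q0 ->]]] := rdegE x0.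
have [p' [q' [p'0 q'0 ->]]] := rdegE y0.
rewrite mulf_div -!tofracM !rdeg_div ?mulf_neq0 //.
rewrite -EFinD; congr (_%:E)%E.
have sM (a b : {poly k}) : a != 0 -> b != 0 ->
    (size (a * b)%R)%:R = (size a)%:R + (size b)%:R - 1 :> R.
  move=> a0 b0; rewrite size_mul // -natrD -[X in _ = X%:R - 1]prednK.
    by rewrite -natr1 addrK.
  by rewrite addn_gt0 size_poly_gt0 a0.
by rewrite !sM //; lra.
Qed.

Lemma rdegN x : v (- x) = v x.
Proof.
have [->|x0] := eqVneq x 0; first by rewrite oppr0.
have [p [q [p0 q0 ->]]] := rdegE x0.
by rewrite -mulNr -tofracN !rdeg_div ?oppr_eq0 // size_polyN.
Qed.

(** Over a common denominator, the ultrametric inequality becomes the bound on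
the degree of a sum of polynomials. *)
Lemma rdeg_common x y : exists p p' q,
  [/\ q != 0, x = tofrac p / tofrac q & y = tofrac p' / tofrac q].
Proof.
exists (\n_(repr x) * \d_(repr y)), (\n_(repr y) * \d_(repr x)),
  (\d_(repr x) * \d_(repr y)).
split; first by rewrite mulf_neq0 ?denom_ratioP.
  by rewrite {1}(ratfun_repr x) (tofrac_expandr _ _ (denom_ratioP (repr y))).
by rewrite {1}(ratfun_repr y) (tofrac_expandl _ _ (denom_ratioP (repr x))).
Qed.

Lemma rdegD x y : (v (x + y) <= Order.max (v x) (v y))%E.
Proof.
have [->|xy0] := eqVneq (x + y) 0; first by rewrite rdeg0 leNye.
have [->|x0] := eqVneq x 0; first by rewrite add0r le_max lexx orbT.
have [->|y0] := eqVneq y 0; first by rewrite addr0 le_max lexx.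
have [p [p' [q [q0 xE yE]]]] := rdeg_common x y.
have nz a : tofrac a / tofrac q != 0 -> a != 0.
  by apply: contraNneq => ->; rewrite tofrac0 mul0r.
move: xy0 x0 y0; rewrite xE yE -mulrDl -tofracD => /nz s0 /nz p0 /nz p'0.
rewrite !rdeg_div // le_max !lee_fin !lerD2r !ler_nat -leq_max.
exact: size_polyD.
Qed.

(** A strictly dominant term cannot be cancelled: otherwise [x = (x + y) - y]
would violate the ultrametric inequality. *)
Lemma rdegD_dominant x y : (v y < v x)%E -> v (x + y) = v x.
Proof.
move=> yx; apply/eqP; rewrite eq_le; apply/andP; split.
  by apply: le_trans (rdegD x y) _; rewrite ge_max lexx ltW.
have := rdegD (x + y) (- y).
by rewrite addrK le_max rdegN [X in _ || X]leNgt yx orbF.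
Qed.

Lemma rdeg_sum_le n (F : 'I_n -> ratfun k) (c : \bar R) :
  (forall i, v (F i) <= c)%E -> (v (\sum_i F i) <= c)%E.
Proof.
move=> h; apply: (big_ind (fun s => v s <= c)%E) => //.
- by rewrite rdeg0 leNye.
- by move=> a b ha hb; apply: le_trans (rdegD a b) _; rewrite ge_max ha hb.
Qed.

Lemma rdeg_sum_lt n (F : 'I_n -> ratfun k) (c : \bar R) :
  (-oo < c)%E -> (forall i, v (F i) < c)%E -> (v (\sum_i F i) < c)%E.
Proof.
move=> c0 h; apply: (big_ind (fun s => v s < c)%E) => //.
- by rewrite rdeg0.
- by move=> a b ha hb; apply: le_lt_trans (rdegD a b) _; rewrite gt_max ha hb.
Qed.

Lemma rdeg1 : v 1 = 0%E.
Proof.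
have := @rdeg_div 1 1 (oner_neq0 _) (oner_neq0 _).
by rewrite subrr tofrac1 divr1.
Qed.

Lemma rdeg_Ainf x : (x \in @Ainf k) = (v x <= 0)%E.
Proof.
rewrite inE /rdeg.
by case: fdeg => [z||] //=; rewrite ?lee_fin ?lerz0 ?leNye.
Qed.

Lemma rdeg_minf x : (x \in @minf k) = (v x < 0)%E.
Proof.
rewrite inE /rdeg.
by case: fdeg => [z||] //=; rewrite ?lte_fin ?ltrz0 ?ltNyr.
Qed.

(** Integrality of the degree: there is no value strictly between [0] and [1]. *)
Lemma rdeg_le0 x (s : R) : s < 1 -> (v x <= s%:E)%E -> (v x <= 0)%E.
Proof.
move=> s1; have [->|x0] := eqVneq x 0; first by rewrite rdeg0 !leNye.
have [z ->] := rdeg_fin x0; rewrite !lee_fin lerz0 => zs.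
by rewrite -ltzD1 add0r -(ltrz1 R); lra.
Qed.

(** Integrality of the degree: a negative value is at most [-1]. *)
Lemma rdeg_lt0 x (s : R) : -1 <= s -> (v x < 0)%E -> (v x <= s%:E)%E.
Proof.
move=> s1; have [->|x0] := eqVneq x 0; first by rewrite rdeg0 leNye.
have [z ->] := rdeg_fin x0; rewrite lte_fin lee_fin ltrz0 => z0.
have : z + 1 <= 0 by rewrite lezD1.
by rewrite -(lerz0 R) intrD; lra.
Qed.

End RealDegree.

(** * Isometries of weighted maximum norms *)

Section WeightedNorm.
Set Implicit Arguments.
Unset Strict Implicit.
Variables (k : fieldType) (R : realType).
Local Notation K := (ratfun k).
Local Notation v := (@rdeg k R).

(** One weight per coordinate: blockwise weights give the norm of the orthogonal
sum, and zero weights give the maximum norm on a single block. *)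
Definition wnorm n (w : 'I_n -> R) (x : 'rV[K]_n) : \bar R :=
  \big[Order.max/-oo%E]_j (v (x ord0 j) + (w j)%:E)%E.
Arguments wnorm [n] w x%_ring_scope.

Lemma wnorm_leP n (w : 'I_n -> R) (x : 'rV_n) (c : \bar R) :
  reflect (forall j, v (x ord0 j) + (w j)%:E <= c)%E (wnorm w x <= c)%E.
Proof.
apply: (iffP (bigmax_leP _ _ _ _)) => [[_ h] j|h]; first exact: h.
by split=> [|j _]; [exact: leNye|exact: h].
Qed.

Lemma le_wnorm n (w : 'I_n -> R) (x : 'rV_n) j :
  (v (x ord0 j) + (w j)%:E <= wnorm w x)%E.
Proof. exact/wnorm_leP. Qed.

Lemma wnorm0 n (w : 'I_n -> R) : wnorm w 0 = -oo%E.
Proof.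
by apply/eqP; rewrite -leeNy_eq; apply/wnorm_leP => j; rewrite mxE rdeg0.
Qed.

Lemma wnorm_attained n (w : 'I_n -> R) (x : 'rV_n) : x != 0 ->
  exists2 j, x ord0 j != 0 & wnorm w x = (v (x ord0 j) + (w j)%:E)%E.
Proof.
case/rV0Pn => j0 xj0.
have [j _ wE] : {j | j \in xpredT &
    wnorm w x = (v (x ord0 j) + (w j)%:E)%E}.
  by apply: (eq_bigmax j0) => // j _; exact: leNye.
exists j; last exact: wE.
have := le_wnorm w x j0; rewrite wE.
apply: contraTneq => ->; rewrite rdeg0.
by have [z ->] := rdeg_fin R xj0.
Qed.

Lemma wnorm_eqNy n (w : 'I_n -> R) (x : 'rV_n) : wnorm w x = -oo%E -> x = 0.
Proof.
move=> h; apply/eqP; apply/negPn/negP => /(wnorm_attained w)[j xj].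
by rewrite h; have [z ->] := rdeg_fin R xj.
Qed.

Definition wisometry n (w : 'I_n -> R) (T : 'M[K]_n) :=
  forall x, wnorm w (x *m T) = wnorm w x.

(** The bound on [T j l] is the [l]-th coordinate of the contraction inequality
at the [j]-th unit vector, whose norm is [w j]; conversely the entrywise bounds
add up by the ultrametric inequality. *)
Lemma wcontractionP n (w : 'I_n -> R) (T : 'M[K]_n) :
  (forall x, wnorm w (x *m T) <= wnorm w x)%E <->
  (forall j l, v (T j l) + (w l)%:E <= (w j)%:E)%E.
Proof.
split=> [h j l|h x].
  have := le_trans (le_wnorm w _ l) (h (delta_mx 0 j)).
  rewrite -rowE mxE => /le_trans; apply; apply/wnorm_leP => i.
  rewrite mxE eqxx /=; case: eqP => [->|_]; first by rewrite rdeg1 add0e.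
  by rewrite rdeg0 leNye.
apply/wnorm_leP => l; rewrite mxE -leeBrDr //; apply: rdeg_sum_le => j.
rewrite leeBrDr // rdegM -addeA; apply: le_trans (le_wnorm w x j).
exact/leeD2l/h.
Qed.

(** An isometry is injective since only [0] has norm [-oo]; finite dimension does
the rest. *)
Lemma wisometry_unit n (w : 'I_n -> R) (T : 'M[K]_n) :
  wisometry w T -> T \in unitmx.
Proof.
move=> iT; rewrite -row_free_unit; apply: inj_row_free => x xT.
by apply: (@wnorm_eqNy _ w); rewrite -iT xT wnorm0.
Qed.

Lemma mxAut_wnorm n (w : 'I_n -> R) (T : 'M[K]_n) :
  mxAut (wnorm w) T <-> wisometry w T.
Proof.
split=> [[]//|iT]; have uT := wisometry_unit iT; split => //.
  by move=> a x y; rewrite mulmxDl scalemxAl.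
by exists (mulmxr (invmx T)) => x /=; rewrite ?mulmxK ?mulmxKV.
Qed.

Lemma wisometry_inv n (w : 'I_n -> R) (T : 'M[K]_n) :
  wisometry w T -> wisometry w (invmx T).
Proof. by move=> iT x; rewrite -iT mulmxKV // (wisometry_unit iT). Qed.

Lemma wisometry_le n (w : 'I_n -> R) (T : 'M[K]_n) : wisometry w T ->
  forall j l, (v (T j l) + (w l)%:E <= (w j)%:E)%E.
Proof. by move=> iT; apply/wcontractionP => x; rewrite iT. Qed.

Lemma mxOver_contraction n (T : 'M[K]_n) :
  T \is a mxOver (@Ainf k) <->
  (forall x, wnorm (fun=> 0%R : R) (x *m T) <= wnorm (fun=> 0%R : R) x)%E.
Proof.
rewrite wcontractionP; split=> [/mxOverP h j l|h].
  by have := h j l; rewrite (rdeg_Ainf R) adde0.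
by apply/mxOverP => j l; have := h j l; rewrite (rdeg_Ainf R) adde0.
Qed.

(** A matrix over the valuation ring is a contraction of the maximum norm, so if
its inverse is over the valuation ring too, neither can strictly decrease the
norm. *)
Lemma GLinfP n (T : 'M[K]_n) : GLinf T <-> wisometry (fun=> 0%R : R) T.
Proof.
split=> [[/mxOver_contraction cT [U /mxOver_contraction cU [TU _]]] x|iT].
  apply/eqP; rewrite eq_le cT /=.
  by rewrite -[X in (wnorm _ X <= _)%E]mulmx1 -TU mulmxA cU.
have uT := wisometry_unit iT; split.
  by apply/mxOver_contraction => x; rewrite iT.
exists (invmx T); last by rewrite mulmxV ?mulVmx.
by apply/mxOver_contraction => x; rewrite wisometry_inv.
Qed.

End WeightedNorm.

(** * Block decomposition *)

Section Blocks.
Set Implicit Arguments.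
Unset Strict Implicit.
Variables (k : fieldType) (kappa : nat) (m : 'I_kappa -> nat).
Local Notation K := (ratfun k).
Local Notation n := (\sum_(i < kappa) m i)%N.

(** [submxcol 1%:M i] is the inclusion of the [i]-th summand; writing it as a
matrix makes its composition with a block matrix a matter of associativity. *)
Definition inblock i (y : 'rV[K]_(m i)) : 'rV[K]_n :=
  y *m submxcol 1%:M i.

Lemma inblock_in i (y : 'rV[K]_(m i)) a :
  inblock y ord0 (tagnat.Rank i a) = y ord0 a.
Proof.
rewrite !mxE (bigD1 a) //= !mxE eqxx mulr1 big1 ?addr0 // => b ba.
rewrite !mxE [_ == _](_ : _ = false) ?mulr0 //; apply: contraNF ba => /eqP e.
have := tagnat.eq_Rank b a; rewrite e !eqxx /=.
by move/esym/eqP/val_inj => ->.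
Qed.

Lemma inblock_out i (y : 'rV[K]_(m i)) j :
  tagnat.sig1 j != i -> inblock y ord0 j = 0.
Proof.
move=> ji; rewrite !mxE big1 // => b _.
rewrite !mxE [_ == _](_ : _ = false) ?mulr0 //; apply: contraNF ji => /eqP <-.
by rewrite tagnat.Rank1K.
Qed.

Lemma submxrow_inblock i (y : 'rV[K]_(m i)) (T : 'M[K]_n) :
  submxrow (inblock y *m T) i = y *m submxblock T i i.
Proof.
by rewrite -mulmxA submxcol_mul mul1mx -mul_submxrow submxblockEv.
Qed.

Lemma sig_RankP i (j : 'I_n) :
  tagnat.sig1 j = i -> exists a, j = tagnat.Rank i a.
Proof. by move=> <-; exists (tagnat.sig2 j); rewrite tagnat.sig2K. Qed.

Variables (R : realType) (r : 'I_kappa -> R).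
Hypothesis r_incr : forall i j : 'I_kappa, (i < j)%N -> r i < r j.
Hypothesis r_bnd : forall i, -1 < r i <= 0.
Local Notation v := (@rdeg k R).
Local Notation w := (fun j : 'I_n => r (tagnat.sig1 j)).

(** Here the hypotheses on the weights meet integrality: two weights differ by
less than [1], so equal weighted degrees have equal integral parts, hence equal
weights. *)
Lemma weighted_degree_inj (a b : K) i j : a != 0 ->
  (v a + (r i)%:E)%E = (v b + (r j)%:E)%E -> i = j.
Proof.
move=> a0; have [za ->] := rdeg_fin R a0.
have [->|b0] := eqVneq b 0; first by rewrite rdeg0.
have [zb ->] := rdeg_fin R b0; rewrite -!EFinD => -[e].
have /andP[ri1 ri0] := r_bnd i; have /andP[rj1 rj0] := r_bnd j.
have zab : za = zb.
  apply/eqP; rewrite eq_le -!ltzD1 -!(ltr_int R) !intrD.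
  by apply/andP; split; lra.
have rij : r i = r j by move: e; rewrite zab; lra.
by apply: val_inj; case: (ltngtP i j) => // /r_incr; rewrite rij ltxx.
Qed.

(** The value of the norm alone reveals the leading block and the maximum norm of
the component there. *)
Lemma wnorm_leading_block (x : 'rV[K]_n) (a : K) i : a != 0 ->
  wnorm w x = (v a + (r i)%:E)%E -> wnorm (fun=> 0%R : R) (submxrow x i) = v a.
Proof.
move=> a0 xE.
have x0 : x != 0.
  apply: contra_eq_neq xE => ->; rewrite wnorm0.
  by have [z ->] := rdeg_fin R a0.
have [j xj jE] := wnorm_attained w x0.
have ij : i = tagnat.sig1 j.
  by apply: (@weighted_degree_inj a (x ord0 j)); rewrite -?xE.
apply/eqP; rewrite eq_le; apply/andP; split.
  apply/wnorm_leP => b; rewrite adde0 mxE -(@leeD2rE _ (r i)%:E) // -xE.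
  by have := le_wnorm w x (tagnat.Rank i b); rewrite tagnat.Rank1K.
have [b bE] := sig_RankP (esym ij).
have := le_wnorm (fun=> 0%R : R) (submxrow x i) b; rewrite /= adde0 mxE -bE.
by rewrite -(@leeD2rE _ (r i)%:E (v (x ord0 j))) // {1}ij -jE xE leeD2rE.
Qed.

Lemma wnorm_inblock i (y : 'rV[K]_(m i)) :
  wnorm w (inblock y) = (wnorm (fun=> 0%R : R) y + (r i)%:E)%E.
Proof.
apply/eqP; rewrite eq_le; apply/andP; split.
  apply/wnorm_leP => j; have [ji|ji] := eqVneq (tagnat.sig1 j) i; last first.
    by rewrite inblock_out // rdeg0 leNye.
  have [b ->] := sig_RankP ji.
  rewrite inblock_in tagnat.Rank1K leeD2rE //.
  by have := le_wnorm (fun=> 0%R : R) y b; rewrite /= adde0.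
rewrite -leeBrDr //; apply/wnorm_leP => b; rewrite adde0 leeBrDr //.
by have := le_wnorm w (inblock y) (tagnat.Rank i b);
  rewrite inblock_in tagnat.Rank1K.
Qed.

(** The diagonal block [T_ii] is seen through the vectors supported in block [i]:
their images keep the same leading block. *)
Lemma wisometry_orthonormal (T : 'M[K]_n) :
  wisometry w T -> orthonormal_group k m T.
Proof.
move=> iT; have leT j l : (v (T j l) <= (w j - w l)%:E)%E.
  by rewrite EFinB leeBrDr //; exact: (wisometry_le iT).
split=> [|i|i j ij].
- apply/mxOverP => j l; rewrite (rdeg_Ainf R); apply: rdeg_le0 (leT j l).
  have /andP[? ?] := r_bnd (tagnat.sig1 j).
  by have /andP[? ?] := r_bnd (tagnat.sig1 l); lra.
- apply/(GLinfP R) => y; have [->|y0] := eqVneq y 0; first by rewrite mul0mx.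
  have [b yb] := wnorm_attained (fun=> 0%R : R) y0; rewrite /= adde0 => yE.
  rewrite yE -submxrow_inblock; apply: wnorm_leading_block => //.
  by rewrite iT wnorm_inblock yE.
- apply/mxOverP => a b; rewrite mxE (rdeg_minf R).
  apply: le_lt_trans (leT _ _) _; rewrite !tagnat.Rank1K lte_fin.
  by rewrite subr_lt0 r_incr.
Qed.

(** The entrywise conditions make [T] a contraction.  For the reverse inequality,
split [x] into its leading component [inblock y] and the rest: in the
coordinate where [y T_ii] is largest, the rest is too small to cancel it. *)
Lemma orthonormal_wisometry (T : 'M[K]_n) :
  orthonormal_group k m T -> wisometry w T.
Proof.
move=> [/mxOverP AT GT mT].
have leT j l : (v (T j l) + (w l)%:E <= (w j)%:E)%E.
  rewrite -leeBrDr // -EFinB.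
  have /andP[? ?] := r_bnd (tagnat.sig1 j).
  have /andP[? ?] := r_bnd (tagnat.sig1 l).
  case: (ltnP (tagnat.sig1 j) (tagnat.sig1 l)) => [jl|].
    apply: rdeg_lt0; first by lra.
    have /mxOverP := mT _ _ jl.
    move=> /(_ (tagnat.sig2 j) (tagnat.sig2 l)).
    by rewrite mxE !tagnat.sig2K (rdeg_minf R).
  rewrite leq_eqVlt => jl; have := AT j l; rewrite (rdeg_Ainf R).
  move/le_trans; apply; rewrite lee_fin subr_ge0.
  by case/orP: jl => [/eqP/val_inj->//|/r_incr/ltW].
move=> x; apply/eqP; rewrite eq_le.
rewrite (proj2 (wcontractionP w T) leT) /=.
have [->|x0] := eqVneq x 0; first by rewrite wnorm0 leNye.
have [j xj xE] := wnorm_attained w x0.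
set i := tagnat.sig1 j in xE *.
pose y := submxrow x i.
have yE : wnorm (fun=> 0%R : R) (y *m submxblock T i i) = v (x ord0 j).
  have /(GLinfP R) -> := GT i.
  exact: wnorm_leading_block.
have y0 : y *m submxblock T i i != 0.
  apply: contra_eq_neq yE => ->; rewrite wnorm0.
  by have [z ->] := rdeg_fin R xj.
have [b _] := wnorm_attained (fun=> 0%R : R) y0.
rewrite yE /= adde0 -submxrow_inblock mxE; set l := tagnat.Rank i b => bE.
have wl : w l = r i by rewrite tagnat.Rank1K.
rewrite xE -wl bE.
suff <- : v ((x *m T) ord0 l) = v ((inblock y *m T) ord0 l) by exact: le_wnorm.
rewrite -[x in LHS](subrK (inblock y)) mulmxDl mxE addrC.
apply: rdegD_dominant; rewrite -bE mxE; apply: rdeg_sum_lt.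
  by have [z ->] := rdeg_fin R xj; rewrite ltNyr.
move=> h; rewrite rdegM.
have [hi|hi] := eqVneq (tagnat.sig1 h) i.
  (* Inside block [i] the vector [x - inblock y] vanishes. *)
  have [c hE] := sig_RankP hi.
  rewrite !mxE [X in x _ _ + X](_ : _ = - x ord0 h).
    by rewrite subrr rdeg0 /=; have [z ->] := rdeg_fin R xj; rewrite ltNyr.
  by have := inblock_in y c; rewrite -hE [in X in _ = X -> _]mxE -hE mxE => ->.
rewrite !mxE [X in x _ _ + X](_ : _ = 0); last first.
  by have := inblock_out y hi; rewrite mxE => ->; rewrite oppr0.
(* Outside block [i] the weighted degree of [x 0 h] is at most the norm, and it
   cannot equal the norm, as this would put [h] in block [i]. *)
rewrite addr0 -(@lteD2rE _ (w l)%:E) // -addeA.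
apply: le_lt_trans (leeD2l _ (leT h l)) _; rewrite wl -xE.
rewrite lt_neqAle le_wnorm andbT xE; apply: contra_neq hi => e.
by apply/esym/(weighted_degree_inj xj); rewrite -e.
Qed.

End Blocks.

Theorem theorem1p27 (k : fieldType) (R : realType) (kappa : nat)
    (m : 'I_kappa -> nat) (r : 'I_kappa -> R)
    (hkappa : (0 < kappa)%N)
    (hm : forall i, (0 < m i)%N)
    (hr_incr : forall i j : 'I_kappa, (i < j)%N -> r i < r j)
    (hr_bnd : forall i, -1 < r i <= 0) :
  mxAut (perp_norm k m r) = orthonormal_group k m.
Proof.
apply/seteqP; split=> T.
  by move/mxAut_wnorm; apply: wisometry_orthonormal.
by move=> oT; apply/mxAut_wnorm; apply: orthonormal_wisometry.
Qed.
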